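(* Let $t$ be a positive integer. If $G$ is an induced-subgraph-minimal graph having a pivot-minor isomorphic to $P_3+tP_1$, then $|V(G)|\le (t+1)(2^{t+3}-t-4)+2$.
   Context: Graphs are finite, without loops or multiple edges. $P_3+tP_1$ is the disjoint union of the path on three vertices and $t$ isolated vertices. For a vertex $u$ of a graph $G$, the local complementation $G*u$ is obtained from $G$ by complementing the adjacency between every pair of distinct neighbours of $u$. For an edge $uv$ of $G$, the edge pivot is $G\wedge uv=((G*u)*v)*u$. A graph $G$ contains $H$ as a pivot-minor if $H$ can be obtained from $G$ by a sequence of vertex deletions and edge pivots. A graph $G$ is an induced-subgraph-minimal graph having a pivot-minor isomorphic to $H$ if $G$ has a pivot-minor isomorphic to $H$ but no proper induced subgraph of $G$ does. *)

(* Defs.v *)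
From mathcomp Require Import all_boot.

Set Implicit Arguments.
Unset Strict Implicit.
Unset Printing Implicit Defensive.

Record sgraph := SGraph {
  vertex :> finType;
  adj : rel vertex;
  adj_sym : symmetric adj;
  adj_irr : irreflexive adj }.

Definition isomorphic (G H : sgraph) : Prop :=
  exists2 f : G -> H, bijective f & forall x y, adj (f x) (f y) = adj x y.

Section Operations.
Variable G : sgraph.

Section Induced.
Variable S : {set G}.

Definition induced_adj : rel {x : G | x \in S} :=
  fun x y => adj (val x) (val y).

Lemma induced_adj_sym : symmetric induced_adj.
Proof. by move=> x y; apply: adj_sym. Qed.

Lemma induced_adj_irr : irreflexive induced_adj.
Proof. by move=> x; apply: adj_irr. Qed.

Definition induced : sgraph := SGraph induced_adj_sym induced_adj_irr.

End Induced.

Definition del_vertex (v : G) : sgraph := induced [set~ v].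

Definition local_compl_adj (u : G) : rel G := fun x y =>
  if [&& x != y, adj u x & adj u y] then ~~ adj x y else adj x y.

Lemma local_compl_adj_sym u : symmetric (local_compl_adj u).
Proof.
move=> x y; rewrite /local_compl_adj eq_sym (adj_sym x y).
by rewrite [adj u x && _]andbC.
Qed.

Lemma local_compl_adj_irr u : irreflexive (local_compl_adj u).
Proof. by move=> x; rewrite /local_compl_adj eqxx /= adj_irr. Qed.

Definition local_compl (u : G) : sgraph :=
  SGraph (local_compl_adj_sym u) (local_compl_adj_irr u).

End Operations.

(* [local_compl] keeps the vertex type, so [u] and [v] are also vertices of the
   intermediate graphs. [pivot G u v] is only used below when [adj u v]. *)
Definition pivot (G : sgraph) (u v : G) : sgraph :=
  @local_compl (@local_compl (@local_compl G u) v) u.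

Inductive pivot_minor (G : sgraph) : sgraph -> Prop :=
| pivot_minor_refl : pivot_minor G G
| pivot_minor_del (K : sgraph) (v : K) :
    pivot_minor G K -> pivot_minor G (del_vertex v)
| pivot_minor_pivot (K : sgraph) (u v : K) :
    adj u v -> pivot_minor G K -> pivot_minor G (pivot u v).

Definition has_pivot_minor (G H : sgraph) : Prop :=
  exists2 K : sgraph, pivot_minor G K & isomorphic K H.

Definition minimal_with_pivot_minor (H G : sgraph) : Prop :=
  has_pivot_minor G H /\
  forall S : {set G}, S \proper [set: G] -> ~ has_pivot_minor (induced S) H.

Definition path_adj n : rel 'I_n := fun i j => (i.+1 == j) || (j.+1 == i).

Lemma path_adj_sym n : symmetric (@path_adj n).
Proof. by move=> i j; apply: orbC. Qed.

Lemma path_adj_irr n : irreflexive (@path_adj n).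
Proof. by move=> i; rewrite /path_adj orbb; apply/negbTE; rewrite gtn_eqF. Qed.

Definition path_graph n : sgraph := SGraph (@path_adj_sym n) (@path_adj_irr n).

Definition edgeless_adj n : rel 'I_n := fun _ _ => false.

Lemma edgeless_adj_sym n : symmetric (@edgeless_adj n).
Proof. by []. Qed.

Lemma edgeless_adj_irr n : irreflexive (@edgeless_adj n).
Proof. by []. Qed.

Definition edgeless n : sgraph :=
  SGraph (@edgeless_adj_sym n) (@edgeless_adj_irr n).

Section DisjointUnion.
Variables G H : sgraph.

Definition dunion_adj : rel (G + H)%type := fun x y =>
  match x, y with
  | inl a, inl b => adj a b
  | inr a, inr b => adj a b
  | _, _ => false
  end.

Lemma dunion_adj_sym : symmetric dunion_adj.
Proof. by move=> [a|a] [b|b] //=; apply: adj_sym. Qed.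

Lemma dunion_adj_irr : irreflexive dunion_adj.
Proof. by move=> [a|a] /=; apply: adj_irr. Qed.

Definition dunion : sgraph := SGraph dunion_adj_sym dunion_adj_irr.

End DisjointUnion.

Definition P3_plus_P1s t : sgraph := dunion (path_graph 3) (edgeless t).

(* Main.v *)
(* Adjacency matrices are taken over GF(2) and pivoting is the principal pivot
   transform: it exchanges, on a set X of coordinates, arguments and values of
   the linear map. Let B be a graph on V(G) pivot-equivalent to G, obtained by a
   transform on X, in which S induces P3 + tP1. By minimality every v outside S
   lies in X, and no contraction of v in B (pivot on an edge vw, then delete v)
   has an induced P3 + tP1. Sort the vertices outside S by their trace, the set N
   of their neighbours in S. Two vertices of the same trace are nonadjacent, since
   pivoting on such an edge leaves S unchanged, and N is never empty. Contracting
   one vertex of a class through a vertex of N isolates the rest of the class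
   from S. So the class has at most t vertices as soon as the contraction leaves a
   P3 in S, which happens unless N is {a}, {b}, {c} or {a,c}, where P3 = abc.
   Every class has at most 2t vertices: X being nonsingular, two members of a
   class are separated by some v outside S, and after contracting a vertex on the
   majority side of v, there is a P3 z-v-q with z on the other side and q in S,
   while the rest of the majority side is isolated. Altogether
   |V(G)| <= (t + 3) + t 2^(t+3) + 4t. *)
Require Import Defs.
From mathcomp Require Import all_boot.
From mathcomp Require Import zify.

Set Implicit Arguments.
Unset Strict Implicit.
Unset Printing Implicit Defensive.

(** * Principal pivot transforms over GF(2) *)

Section PrincipalPivoting.
Variable V : finType.
Implicit Types (A B C : rel V) (f g : V -> bool) (X Y : {set V}).

Definition mulv A f x := \big[addb/false]_y (A x y && f y).

Definition swap_on X f g : V -> bool := fun x => if x \in X then g x else f x.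

(* [B] is the principal pivot transform of [A] on [X]; no invertibility of the
   principal submatrix is assumed, it follows from the existence of [B]. *)
Definition twist X A B :=
  forall f g, g =1 mulv A f -> swap_on X g f =1 mulv B (swap_on X f g).

Definition closed_nbhd A u : pred V := fun x => (x == u) (+) A x u.

(* Exchanges the adjacencies of u and v and toggles the pairs between the
   classes N(u) - N(v), N(v) - N(u) and N(u) :&: N(v); the closed neighbourhoods
   make one formula valid for all pairs, including those meeting {u, v}. *)
Definition piv A u v : rel V := fun x y =>
  A x y (+) (closed_nbhd A u x && closed_nbhd A v y)
        (+) (closed_nbhd A v x && closed_nbhd A u y).

Lemma eq_mulvl A B f : A =2 B -> mulv A f =1 mulv B f.
Proof. by move=> eAB x; apply: eq_bigr => y _; rewrite eAB. Qed.

Lemma eq_mulvr A f g : f =1 g -> mulv A f =1 mulv A g.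
Proof. by move=> efg x; apply: eq_bigr => y _; rewrite efg. Qed.

Lemma mulvD A f g x :
  mulv A (fun y => f y (+) g y) x = mulv A f x (+) mulv A g x.
Proof.
rewrite -big_split /=; apply: eq_bigr => y _.
by case: (A x y).
Qed.

Lemma mulv_delta A u b x : mulv A (fun y => (y == u) && b) x = A x u && b.
Proof.
rewrite /mulv (bigD1 u) //= eqxx big1 ?addbF // => y /negbTE ->.
by rewrite andbF.
Qed.

Lemma mulv0 A f x : f =1 xpred0 -> mulv A f x = false.
Proof. by move=> f0; apply: big1 => y _; rewrite f0 andbF. Qed.

Lemma mulv_piv A u v f x : mulv (piv A u v) f x =
  mulv A f x (+) (closed_nbhd A u x && \big[addb/false]_y (closed_nbhd A v y && f y))
   (+) (closed_nbhd A v x && \big[addb/false]_y (closed_nbhd A u y && f y)).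
Proof.
rewrite !big_distrr /= -!big_split /=; apply: eq_bigr => y _.
by rewrite /piv; case: (f y); rewrite ?andbT ?andbF.
Qed.

Lemma big_closed_nbhd A u f : symmetric A ->
  \big[addb/false]_y (closed_nbhd A u y && f y) = f u (+) mulv A f u.
Proof.
move=> symA; rewrite -[f u]/(true && f u) -(mulv_delta (fun _ _ => true) u (f u) u).
rewrite -big_split /=; apply: eq_bigr => y _.
by rewrite /closed_nbhd andb_addl symA; case: eqP => [->|].
Qed.

Lemma twist_piv A u v : symmetric A -> irreflexive A -> A u v ->
  twist [set u; v] A (piv A u v).
Proof.
move=> symA irrA Auv f g gE x.
have Avu : A v u by rewrite symA.
have neq_uv : (u == v) = false by apply/eqP => e; rewrite e irrA in Auv.
set f' := swap_on _ f g.
have f'E : f' =1 (fun y => f y (+) ((y == u) && (f u (+) g u))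
                              (+) ((y == v) && (f v (+) g v))).
  move=> y; rewrite /f' /swap_on !inE.
  case: (eqVneq y u) => [->|_]; first by rewrite neq_uv /=; case: (f u); case: (g u).
  case: (eqVneq y v) => [->|_] /=; first by case: (f v); case: (g v).
  by rewrite !addbF.
have Af' y : mulv A f' y = g y (+) (A y u && (f u (+) g u)) (+) (A y v && (f v (+) g v)).
  by rewrite (eq_mulvr A f'E) !mulvD !mulv_delta -gE.
rewrite mulv_piv !big_closed_nbhd // !Af' !f'E /swap_on !inE /closed_nbhd.
rewrite !irrA Auv Avu !eqxx neq_uv (eq_sym v u) neq_uv.
case: (eqVneq x u) => [->|_].
  by rewrite irrA Auv neq_uv; case: (f u); case: (g u); case: (f v); case: (g v).
case: (eqVneq x v) => [->|_].
  by rewrite irrA Avu; case: (f u); case: (g u); case: (f v); case: (g v).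
by case: (f u); case: (g u); case: (f v); case: (g v); case: (A x u); case: (A x v); case: (g x).
Qed.

Lemma piv_sym A u v : symmetric A -> symmetric (piv A u v).
Proof.
by move=> symA x y; rewrite /piv symA -!addbA [X in _ (+) X]addbC ![_ && closed_nbhd _ _ y]andbC.
Qed.

Lemma piv_irr A u v : irreflexive A -> irreflexive (piv A u v).
Proof. by move=> irrA x; rewrite /piv irrA /= andbC addbb. Qed.

Section Edge.
Variables (A : rel V) (u v : V).
Hypotheses (symA : symmetric A) (irrA : irreflexive A) (Auv : A u v).

Let closed_nbhdE x y : A x y -> closed_nbhd A y x.
Proof.
by rewrite /closed_nbhd => Axy; rewrite Axy; case: eqP => // e; rewrite e irrA in Axy.
Qed.

(** This swap merely exchanges the two correction terms of [piv], so a second pivot cancels the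
    first. *)
Lemma closed_nbhd_piv x :
  (closed_nbhd (piv A u v) u x = closed_nbhd A v x) *
  (closed_nbhd (piv A u v) v x = closed_nbhd A u x).
Proof.
have Avu : A v u by rewrite symA.
split; rewrite {1}/closed_nbhd /piv.
  rewrite (closed_nbhdE Auv) /closed_nbhd eqxx irrA.
  by case: (x == u); case: (x == v); case: (A x u); case: (A x v).
rewrite (closed_nbhdE Avu) /closed_nbhd eqxx irrA.
by case: (x == u); case: (x == v); case: (A x u); case: (A x v).
Qed.

Lemma pivK : piv (piv A u v) u v =2 A.
Proof.
move=> x y; rewrite {1}/piv !closed_nbhd_piv /piv.
by case: (A x y); case: (_ && _); case: (_ && _).
Qed.

Lemma piv_edge : piv A u v u v.
Proof.
have Avu : A v u by rewrite symA.
by rewrite /piv (closed_nbhdE Auv) (closed_nbhdE Avu) Auv /closed_nbhd !eqxx !irrA.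
Qed.

Lemma twist_pivV : twist [set u; v] (piv A u v) A.
Proof.
move=> f g gE x.
rewrite (twist_piv (piv_sym u v symA) (piv_irr u v irrA) piv_edge gE).
exact: eq_mulvl pivK x.
Qed.

End Edge.

Lemma eq_twistl X A A' B : A =2 A' -> twist X A B -> twist X A' B.
Proof. by move=> eA tX f g gE; apply: tX => x; rewrite gE; apply: eq_mulvl. Qed.

Lemma twist0 A : twist set0 A A.
Proof.
move=> f g gE x; rewrite /swap_on inE gE; apply: eq_mulvr => y.
by rewrite inE.
Qed.

Definition symdiff X Y := (X :\: Y) :|: (Y :\: X).

Lemma symdiffC X Y : symdiff X Y = symdiff Y X.
Proof. exact: setUC. Qed.

Lemma twist_trans X Y A B C :
  twist X A B -> twist Y B C -> twist (symdiff X Y) A C.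
Proof.
move=> tAB tBC f g gE x.
have sE h k : swap_on (symdiff X Y) h k =1 swap_on Y (swap_on X h k) (swap_on X k h).
  by move=> y; rewrite /swap_on !inE; case: (y \in X); case: (y \in Y).
rewrite sE (tBC _ _ (tAB _ _ gE)); apply: eq_mulvr => y; exact/esym/sE.
Qed.

Lemma twist0_eq A B : twist set0 A B -> A =2 B.
Proof.
move=> tAB x y; pose f z := (z == y) && true.
have := tAB f _ (frefl _) x; rewrite {1}/swap_on inE mulv_delta andbT => ->.
rewrite -[RHS]andbT -(mulv_delta B y true x); apply: eq_mulvr => z.
by rewrite /swap_on inE.
Qed.

(** Exchanging turns the argument [f] into 0 and its value 0 into [f] on [X], while [B] maps 0 to
    0. *)
Lemma twist_kernel X A B f : twist X A B -> (forall x, f x -> x \in X) ->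
  mulv A f =1 xpred0 -> f =1 xpred0.
Proof.
move=> tAB fX Af0 x; apply/negbTE/negP => fx.
have /(_ x) := tAB f xpred0 (fun y => esym (Af0 y)).
rewrite {1}/swap_on (fX _ fx) fx mulv0 // => y; rewrite /swap_on.
by case: ifPn => // /negP yX; apply/negP => /fX.
Qed.

(** Otherwise exchanging turns the unit vector at [x] into the argument 0, with value 1 at [x]. *)
Lemma twist_edge X A B x : symmetric A -> twist X A B -> x \in X ->
  exists2 y, y \in X & A x y.
Proof.
move=> symA tAB xX.
case: (boolP [exists y in X, A x y]) => [/exists_inP //|/exists_inPn noe].
pose f y := (y == x) && true.
have /(_ x) := tAB f _ (frefl _).
rewrite {1}/swap_on xX /f eqxx mulv0 // => y; rewrite /swap_on.
case: ifPn => yX; last by case: eqP yX => // ->; rewrite xX.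
by rewrite mulv_delta andbT symA; apply/negbTE/noe.
Qed.

End PrincipalPivoting.

(** * Pivot-minors as induced copies in transforms *)

Lemma local_compl_adjE (G : sgraph) (u x y : G) :
  @adj (local_compl u) x y = adj x y (+) [&& x != y, adj x u & adj y u].
Proof.
rewrite /= /local_compl_adj !(adj_sym u).
by case: ifP => _; rewrite ?addbT ?addbF.
Qed.

Lemma adj_pivot (G : sgraph) (u v : G) : adj u v ->
  forall x y : G, @adj (pivot u v) x y = piv (@adj G) u v x y.
Proof.
move=> uv x y; have vu : adj v u by rewrite adj_sym.
have neq_uv : (u == v) = false by apply/eqP => e; rewrite e adj_irr in uv.
pose G1 := @local_compl G u; pose G2 := @local_compl G1 v.
rewrite (@local_compl_adjE G2 u) !(@local_compl_adjE G1 v) !(@local_compl_adjE G u).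
rewrite /piv /closed_nbhd !adj_irr uv vu neq_uv.
case: (eqVneq x y) => [->|neq_xy]; first by rewrite adj_irr /= andbC addbb.
have adjE z : (adj u z = adj z u) * (adj v z = adj z v) by split; apply: adj_sym.
case: (eqVneq x u) neq_xy => [->|_] neq_xy.
  rewrite adj_irr uv ?adjE neq_uv; rewrite eq_sym in neq_xy; rewrite (negbTE neq_xy).
  case: (eqVneq y v) => [->|_]; first by rewrite adj_irr vu.
  by case: (adj y u); case: (adj y v).
case: (eqVneq y u) neq_xy => [->|_] neq_xy.
  rewrite adj_irr uv ?adjE neq_uv.
  case: (eqVneq x v) => [->|_]; first by rewrite adj_irr vu.
  by case: (adj x u); case: (adj x v).
case: (eqVneq x v) neq_xy => [->|_] neq_xy.
  rewrite adj_irr vu ?adjE; rewrite eq_sym in neq_xy; rewrite (negbTE neq_xy).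
  by case: (adj y u); case: (adj y v).
case: (eqVneq y v) neq_xy => [->|_] neq_xy.
  by rewrite adj_irr vu; case: (adj x u); case: (adj x v).
by case: (adj x y); case: (adj x u); case: (adj x v); case: (adj y u); case: (adj y v).
Qed.

Lemma pivot_minor_trans (G K L : sgraph) :
  pivot_minor G K -> pivot_minor K L -> pivot_minor G L.
Proof.
move=> GK; elim=> {L} [//|L v _|L u v uv _] GL; first exact: pivot_minor_del.
exact: pivot_minor_pivot.
Qed.

(** [B] is a bare relation, so that all transforms of one graph share its vertex type. *)
Definition copy (V : finType) (B : rel V) (H : sgraph) (phi : H -> V) :=
  injective phi /\ forall x y, B (phi x) (phi y) = adj x y.

(** Deletions are postponed: the transform acts on all of [G], and the image of [phi] records the
    surviving vertices. *)
Lemma pivot_minor_twist (G K : sgraph) : pivot_minor G K ->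
  exists X B, [/\ symmetric B, irreflexive B, twist X (@adj G) B,
    twist X B (@adj G) & exists phi : K -> G, copy B phi].
Proof.
elim=> {K} [|K v _ [X [B [sB iB tX tX' [phi [inj hom]]]]]
            |K u v uv _ [X [B [sB iB tX tX' [phi [inj hom]]]]]].
- exists set0, (@adj G); split; [exact: adj_sym|exact: adj_irr|exact: twist0|exact: twist0|].
  by exists id; split.
- exists X, B; split=> //; exists (fun x => phi (val x)); split=> [x y /inj /val_inj //|x y].
  exact: hom.
- have Buv : B (phi u) (phi v) by rewrite hom.
  exists (symdiff X [set phi u; phi v]), (piv B (phi u) (phi v)); split.
  + exact: piv_sym.
  + exact: piv_irr.
  + exact: twist_trans tX (twist_piv sB iB Buv).
  + rewrite symdiffC; exact: twist_trans (twist_pivV sB iB Buv) tX'.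
  + exists phi; split=> // x y; rewrite adj_pivot // /piv /closed_nbhd.
    by rewrite !hom !(inj_eq inj).
Qed.

(** Pivoting on an edge of [K] inside [Z] removes its ends from [Z]. Once [Z] is empty, [B] is the
    adjacency of [K], and the vertices off the copy are deleted one by one. *)
Lemma has_pivot_minor_twist (H K : sgraph) (Z : {set K}) (B : rel K) (phi : H -> K) :
  twist Z (@adj K) B -> copy B phi -> has_pivot_minor K H.
Proof.
have [n] := ubnP (#|Z| + #|K|); elim: n K Z B phi => // n IHn K Z B phi leZn tZ [inj hom].
have [Z0|[u uZ]] := set_0Vmem Z.
  have eB : @adj K =2 B by apply: twist0_eq; rewrite -Z0.
  case: (boolP [forall v, [exists x, phi x == v]]) => [/forallP surj|].
    exists K; first exact: pivot_minor_refl.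
    have [|phi' phiK phi'K] := inj_card_bij inj.
      rewrite -(card_codom inj); apply/subset_leq_card/subsetP => v _.
      by have /existsP[x /eqP <-] := surj v; apply: codom_f.
    exists phi'; first by exists phi.
    by move=> x y; rewrite -hom !phi'K eB.
  rewrite negb_forall => /existsP[v /existsPn nv].
  have phiP x : phi x \in [set~ v] by rewrite !inE nv.
  pose psi x : del_vertex v := exist _ (phi x) (phiP x).
  have [||L KL LH] := IHn (del_vertex v) set0 (@adj (del_vertex v)) psi _ (@twist0 _ _).
  - have -> : #|del_vertex v| = #|K|.-1.
      by rewrite card_sig -(cardsC1 v); apply: eq_card.
    rewrite cards0.
    have : 0 < #|K| by apply/card_gt0P; exists v.
    by lia.
  - by split=> [x y [/inj]//|x y]; rewrite -hom -eB.
  exists L => //; apply: pivot_minor_trans KL.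
  exact/pivot_minor_del/pivot_minor_refl.
have [v vZ uv] := twist_edge (@adj_sym K) tZ uZ.
have tZ' : twist (Z :\: [set u; v]) (@adj (pivot u v)) B.
  apply: (@eq_twistl _ _ (piv (@adj K) u v)) => [x y|]; first by rewrite adj_pivot.
  suff -> : Z :\: [set u; v] = symdiff [set u; v] Z.
    exact: twist_trans (twist_pivV (@adj_sym K) (@adj_irr K) uv) tZ.
  apply/setP => x; rewrite !inE; case: (eqVneq x u) => [->|_] /=; first by rewrite uZ.
  by case: (eqVneq x v) => [->|_] /=; rewrite ?vZ ?andbF ?orbF.
have [||L KL LH] := IHn (pivot u v) _ B phi _ tZ'.
- have : #|Z :\: [set u; v]| < #|Z|.
    apply/proper_card/properP; split; first exact: subsetDl.
    by exists u; rewrite ?inE ?eqxx.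
  by move: leZn; rewrite /=; lia.
- by [].
exists L => //; apply: pivot_minor_trans KL.
exact/(pivot_minor_pivot uv)/pivot_minor_refl.
Qed.

(** Vectors are extended by zero outside [W]; as [X] lies in [W], the exchange keeps them zero
    there. *)
Lemma twist_induced (G : sgraph) (W X : {set G}) (B : rel G) :
  X \subset W -> twist X (@adj G) B ->
  twist [set x : induced W | val x \in X] (@adj (induced W))
    (fun x y : induced W => B (val x) (val y)).
Proof.
move=> XW tX f g gE.
pose F (x : G) := if insub x is Some y then f y else false.
have Fval (x : induced W) : F (val x) = f x by rewrite /F valK.
have sum_val (C : rel G) h h' : (forall x : induced W, h' (val x) = h x) ->
    (forall x, x \notin W -> h' x = false) ->
    forall x, \big[addb/false]_y (C x y && h' y) =
      \big[addb/false]_(y : induced W) (C x (val y) && h y).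
  move=> hh h0 x; rewrite (bigID (mem W)) /= [X in _ (+) X]big1 => [|y /h0->]; last exact: andbF.
  by rewrite addbF big_sub; apply: eq_bigr => y _; rewrite hh.
pose g' x := mulv (@adj G) F x.
have F0 x : x \notin W -> F x = false by move=> xW; rewrite /F insubN.
have gval (x : induced W) : g' (val x) = g x.
  by rewrite gE; apply: sum_val.
move=> x; have := tX F g' (frefl _) (val x).
rewrite /swap_on Fval gval inE => ->; apply: sum_val => y.
  by rewrite inE Fval gval.
by move=> yW; rewrite F0 // (contraNF (subsetP XW y) yW).
Qed.

(** If [v] were not in [X], the transform would restrict to [G - v] and keep the copy. *)
Lemma minimal_copy (H G : sgraph) (X : {set G}) (B : rel G) (phi : H -> G) :
  minimal_with_pivot_minor H G -> twist X (@adj G) B -> copy B phi ->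
  forall v, (forall x, phi x != v) -> v \in X.
Proof.
case=> _ minG tX [inj hom] v nv; apply/negPn/negP => vX.
have XW : X \subset [set~ v].
  by apply/subsetP => x xX; rewrite !inE; apply: contraNneq vX => <-.
apply: (minG [set~ v]).
  by apply/properP; split; [exact: subsetT|exists v; rewrite ?inE ?eqxx].
have phiP x : phi x \in [set~ v] by rewrite !inE nv.
apply: (has_pivot_minor_twist (twist_induced XW tX)
  (phi := fun x => exist _ (phi x) (phiP x) : induced [set~ v])).
by split=> [x y [/inj]|x y] //=.
Qed.

(** * Traces on the copy in a minimal graph *)

Section MinimalGraph.
Variables (t : nat) (G : sgraph) (X : {set G}) (B : rel G).
Local Notation H := (P3_plus_P1s t).
Variable phi : H -> G.
Hypotheses (minG : minimal_with_pivot_minor H G).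
Hypotheses (symB : symmetric B) (irrB : irreflexive B).
Hypotheses (tX : twist X (@adj G) B) (tX' : twist X B (@adj G)).
Hypothesis copy_phi : copy B phi.

Definition outside v := v \notin codom phi.
Definition trace v : {set H} := [set x | B (phi x) v].
Definition trace_class (N : {set H}) := [set v | outside v & trace v == N].

Lemma outside_neq v x : outside v -> phi x != v.
Proof. by apply: contraNneq => <-; apply: codom_f. Qed.

Lemma outside_mem v : outside v -> v \in X.
Proof.
move=> ov; apply: (minimal_copy minG tX copy_phi) => x; exact: outside_neq.
Qed.

(* Deleting [v] from the pivoted graph contracts [v] in [B]: the key consequence
   of minimality is that this contraction has no copy of the target graph. *)
Lemma no_copy_contract v w (psi : H -> G) : outside v -> B v w ->
  copy (piv B v w) psi -> (forall x, psi x != v) -> False.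
Proof.
move=> ov Bvw cpsi psiv.
have := minimal_copy minG (twist_trans tX (twist_piv symB irrB Bvw)) cpsi psiv.
by rewrite !inE eqxx outside_mem.
Qed.

Lemma closed_nbhd_outside v x :
  outside v -> closed_nbhd B v (phi x) = (x \in trace v).
Proof. by move=> ov; rewrite /closed_nbhd (negbTE (outside_neq x ov)) inE. Qed.

Lemma closed_nbhd_phi x y :
  closed_nbhd B (phi y) (phi x) = (x == y) (+) adj x y.
Proof. by case: copy_phi => inj hom; rewrite /closed_nbhd (inj_eq inj) hom. Qed.

(** Inside the copy the two correction terms of the pivot on [u] and [v] coincide and cancel. *)
Lemma same_trace_nonadj u v :
  outside u -> outside v -> trace u = trace v -> B u v = false.
Proof.
move=> ou ov euv; apply/negP => Buv; have [inj hom] := copy_phi.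
apply: (no_copy_contract ou Buv (psi := phi)) => [|x]; last exact: outside_neq.
split=> // x y; rewrite /piv !closed_nbhd_outside // euv -hom.
by rewrite -addbA addbb addbF.
Qed.

(** The inverse transform gives [v] a neighbour [w]; with an empty trace, both correction terms of
    the pivot on [v] and [w] vanish on the copy. *)
Lemma trace_neq0 v : outside v -> trace v != set0.
Proof.
move=> ov; apply/eqP => tr0; have [inj hom] := copy_phi.
have [w _ Bvw] := twist_edge symB tX' (outside_mem ov).
apply: (no_copy_contract ov Bvw (psi := phi)) => [|x]; last exact: outside_neq.
by split=> // x y; rewrite /piv !(closed_nbhd_outside _ ov) tr0 !inE andbF !addbF hom.
Qed.

Lemma no_P3_contract v w p q r (I : {set G}) (C := piv B v w) :
  outside v -> B v w -> p != v -> q != v -> r != v -> v \notin I -> t <= #|I| ->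
  p != r -> C p q -> C q r -> ~~ C p r ->
  {in I, forall i, [/\ ~~ C i p, ~~ C i q & ~~ C i r]} ->
  {in I &, forall i j, ~~ C i j} -> False.
Proof.
move=> ov Bvw pv qv rv vI leI pr Cpq Cqr Cpr Iout Iin.
have symC : symmetric C by apply: piv_sym.
have irrC : irreflexive C by apply: piv_irr.
have adjN x y : C x y -> x != y by apply: contraTneq => ->; rewrite irrC.
pose inI (i : 'I_t) : G := enum_val (widen_ord leI i).
have inIP i : inI i \in I by apply: enum_valP.
pose psi (x : H) := match x with inl k => nth p [:: p; q; r] k | inr i => inI i end.
(* Each path vertex has a neighbour on the path, a member of [I] has none. *)
have Inot i k : inI i != nth p [:: p; q; r] (val (k : 'I_3)).
  have [n1 n2 n3] := Iout _ (inIP i).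
  case: k => [[|[|[]]]] //= _; apply/eqP => e.
  - by rewrite -e (negbTE n2) in Cpq.
  - by rewrite -e (negbTE n3) in Cqr.
  - by rewrite -e symC (negbTE n2) in Cqr.
apply: (no_copy_contract ov Bvw (psi := psi)); last first.
  case=> [[[|[|[]]]]|i] //=; by apply: contraNneq vI => <-.
split=> [[k|i] [l|j]|[k|i] [l|j]] /=.
- move=> e; congr inl; apply: val_inj; move: e.
  have /negbTE n1 := adjN _ _ Cpq; have /negbTE n2 := adjN _ _ Cqr.
  case: k l => [[|[|[]]]] //= ? [[|[|[]]]] //= ? /eqP;
  by rewrite ?n1 ?n2 ?(negbTE pr) // eq_sym ?n1 ?n2 ?(negbTE pr).
- by move=> /eqP; rewrite eq_sym (negbTE (Inot _ _)).
- by move=> /eqP; rewrite (negbTE (Inot _ _)).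
- by move=> /enum_val_inj /(congr1 val) /= e; congr inr; apply: val_inj.
- case: k l => [[|[|[]]]] //= ? [[|[|[]]]] //= ?; rewrite -/C ?irrC //;
  by rewrite ?Cpq ?Cqr ?(negbTE Cpr) // symC ?Cpq ?Cqr ?(negbTE Cpr).
- have [n1 n2 n3] := Iout _ (inIP j).
  by case: k => [[|[|[]]]] //= _; rewrite -/C symC; apply/negbTE.
- have [n1 n2 n3] := Iout _ (inIP i).
  by case: l => [[|[|[]]]] //= _; apply/negbTE.
- by apply/negbTE/Iin.
Qed.

(** * Sizes of the trace classes *)

Lemma piv_same_trace v z s y : outside v -> outside z -> trace z = trace v ->
  z != v -> s \in trace v -> y != v ->
  piv B v (phi s) y z = B y z (+) B y v.
Proof.
move=> ov oz ezv zv sv yv.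
(* [z] is adjacent to [phi s] but not to [v], so only the correction [B y v] survives. *)
rewrite /piv /closed_nbhd (negbTE zv) (negbTE yv) (same_trace_nonadj oz ov ezv).
rewrite [z == _]eq_sym (negbTE (outside_neq s oz)) symB.
by move: sv; rewrite -ezv inE symB => ->; rewrite andbT andbF addbF (symB z).
Qed.

Lemma class_pair N z z' : z \in trace_class N -> z' \in trace_class N -> B z z' = false.
Proof.
rewrite !inE => /andP[oz /eqP ez] /andP[oz' /eqP ez'].
by apply: same_trace_nonadj; rewrite ?ez.
Qed.

(* The adjacency, on the copy, after contracting an outside vertex of trace [N]
   through its neighbour [s]. *)
Definition contracted (N : {set H}) (s x y : H) :=
  adj x y (+) ((x \in N) && ((y == s) (+) adj y s))
          (+) (((x == s) (+) adj x s) && (y \in N)).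

(** After contracting a member [v] of an oversized class through [phi s], the other members, at
    least [t], are isolated from the copy and still pairwise nonadjacent. *)
Lemma class_le (N : {set H}) (s p q r : H) : s \in N -> p != r ->
  contracted N s p q -> contracted N s q r -> ~~ contracted N s p r ->
  #|trace_class N| <= t.
Proof.
move=> sN pr pq qr npr; have [inj hom] := copy_phi.
case: leqP => // ltZ; exfalso.
have /card_gt0P[v vZ] : 0 < #|trace_class N| by apply: leq_trans ltZ.
have := vZ; rewrite inE => /andP[ov /eqP ev].
have CE x y : piv B v (phi s) (phi x) (phi y) = contracted N s x y.
  by rewrite /piv !(closed_nbhd_outside _ ov) !closed_nbhd_phi hom ev.
have ZP z : z \in trace_class N :\ v -> [/\ z \in trace_class N, z != v & forall y, y != v ->
    piv B v (phi s) y z = B y z (+) B y v].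
  rewrite in_setD1 => /andP[zv zZ]; split=> // y yv.
  move: zZ; rewrite inE => /andP[oz /eqP ez].
  by apply: piv_same_trace; rewrite // ?ez ?ev.
have Cphi z x : z \in trace_class N :\ v -> ~~ piv B v (phi s) z (phi x).
  case/ZP; rewrite inE => /andP[oz /eqP ez] zv zE.
  rewrite (piv_sym _ _ symB) zE ?outside_neq //.
  have := congr1 (fun A : {set H} => x \in A) (etrans ez (esym ev)).
  by rewrite !inE => ->; rewrite addbb.
apply: (@no_P3_contract v (phi s) (phi p) (phi q) (phi r) (trace_class N :\ v)).
all: rewrite ?(outside_neq _ ov) ?CE ?(inj_eq inj) //.
- by move: sN; rewrite -ev inE symB.
- by rewrite !inE eqxx.
- by move: ltZ; rewrite (cardsD1 v) vZ.
- by move=> i iZ; split; apply: Cphi.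
move=> i j /ZP[iZ iv _] /ZP[jZ jv ->] //.
by rewrite !(@class_pair N).
Qed.

Lemma class_le_double N : 0 < t -> #|trace_class N| <= t + t.
Proof.
move=> t0; case: leqP => // ltZ; exfalso.
have /card_gt1P[z1 [z2 [z1Z z2Z z12]]] : 1 < #|trace_class N|.
  by apply: leq_ltn_trans ltZ; rewrite addn_gt0 t0.
(* Otherwise the sum of the unit vectors at [z1] and [z2], supported on [X], lies in the kernel of
   [B]. *)
have [v Bv] : exists v, B v z1 != B v z2.
  case: (boolP [exists v, B v z1 != B v z2]) => [/existsP //|/existsPn same].
  pose f y := ((y == z1) && true) (+) ((y == z2) && true).
  suff /(_ z1) : f =1 xpred0 by rewrite /f eqxx (negbTE z12).
  apply: (twist_kernel tX') => x.
    rewrite /f !andbT; case: eqP => [->|_]; last case: eqP => [->|//];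
    by move=> _; apply: outside_mem; move: z1Z z2Z; rewrite !inE => /andP[? _] /andP[].
  by rewrite mulvD !mulv_delta !andbT; have := same x; rewrite negbK => /eqP ->; rewrite addbb.
have memZ z : z \in trace_class N -> outside z /\ trace z = N.
  by rewrite inE => /andP[oz /eqP].
have BZ x z : z \in trace_class N -> B (phi x) z = (x \in N).
  by case/memZ=> _ <-; rewrite inE.
have vZ : v \notin trace_class N.
  by apply: contraNN Bv => vZ; rewrite !(@class_pair N).
have ov : outside v.
  by apply: contraNN Bv => /codomP[x ->]; rewrite !BZ.
pose D b := [set z in trace_class N | B v z == b].
have DP b z : z \in D b -> z \in trace_class N /\ B v z = b.
  by rewrite inE => /andP[? /eqP].
have cardD : #|D true| + #|D false| = #|trace_class N|.
  rewrite -(cardsID (D true) (trace_class N)); congr addn; apply: eq_card => z;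
  by rewrite !inE; case: (outside z); case: (trace z == N); case: (B v z).
have Dne b : exists z, z \in D b.
  have [e1|e1] := eqVneq (B v z1) b; first by exists z1; rewrite inE z1Z e1 eqxx.
  exists z2; rewrite inE z2Z /=.
  by move: Bv e1; case: (B v z1); case: (B v z2); case: (b).
have [b ltD] : exists b, t < #|D b|.
  have [?|?] := ltnP t #|D true|; first by exists true.
  exists false; lia.
have [u uD] := Dne b; have [z zD] := Dne (~~ b).
have [[uZ Bvu] [zZ Bvz]] := (DP _ _ uD, DP _ _ zD).
have [[ou eu] [oz ez]] := (memZ _ uZ, memZ _ zZ).
have vu : v != u by apply: contraNneq vZ => ->.
have zu : z != u by apply/eqP => e; move: Bvz; rewrite e Bvu; case: (b).
have /set0Pn[s sN] : N != set0 by rewrite -eu trace_neq0.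
have su : s \in trace u by rewrite eu.
have Bus : B u (phi s) by rewrite symB BZ.
pose C := piv B u (phi s).
have CE y i : y != u -> i \in trace_class N -> i != u -> C y i = B y i (+) B y u.
  move=> yu /memZ[oi ei] iu; apply: piv_same_trace => //; by rewrite ei eu.
have symC : symmetric C by apply: piv_sym.
have Cphi i x : i \in trace_class N -> i != u -> C i (phi x) = false.
  by move=> iZ iu; rewrite symC CE ?outside_neq // !BZ // addbb.
(* Otherwise the case [x = s] makes [B v u] false; then the trace of [v] is [N] if it contains [s],
   and empty if not. Both are excluded. *)
have [x Cvx] : exists x, C v (phi x).
  apply/existsP; rewrite -[X in is_true X]negbK negb_exists; apply/negP => /forallP noC.
  have trE x : (x \in trace v) (+) (B v u && ((x == s) (+) adj x s)) (+) ((s \in trace v) && (x \in N)) = false.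
    apply/negbTE; have := noC x; rewrite /C /piv (closed_nbhd_outside _ ou) closed_nbhd_phi.
    rewrite {1 2}/closed_nbhd (negbTE vu) [v == _]eq_sym (negbTE (outside_neq _ ov)) eu.
    by rewrite !inE !(symB v (phi _)).
  have := trE s; rewrite eqxx adj_irr sN andbT addbC addbA addbb /= andbT => Bvu0.
  have [sv|sv] := boolP (s \in trace v).
    case/negP: vZ; rewrite inE ov; apply/eqP/setP => x.
    have := trE x; rewrite Bvu0 sv /= addbF.
    by case: (x \in trace v); case: (x \in N).
  case/negP: (trace_neq0 ov); apply/eqP/setP => x.
  by have := trE x; rewrite Bvu0 (negbTE sv) /= !addbF in_set0.
have IP i : i \in D b :\ u -> [/\ i \in trace_class N, i != u & B v i = b].
  by rewrite in_setD1 => /andP[iu /DP[]].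
(* Contraction adds [B v u] to the adjacency of [v] with the class, so [v] sees [z] but not the rest
   of the side of [u]. *)
apply: (@no_P3_contract u (phi s) z v (phi x) (D b :\ u)); rewrite -/C.
all: rewrite ?(outside_neq _ ou) //.
- by rewrite !inE eqxx.
- by move: ltD; rewrite (cardsD1 u) uD.
- by rewrite eq_sym outside_neq.
- by rewrite symC CE // Bvz Bvu; case: (b).
- by rewrite Cphi.
- move=> i /IP[iZ iu Bvi]; rewrite Cphi // (symC i v) !CE // Bvi Bvu addbb.
  by rewrite !(@class_pair N).
- by move=> i j /IP[iZ iu _] /IP[jZ ju _]; rewrite CE // !(@class_pair N).
Qed.

(** * Exceptional traces and the final count *)

Let a : H := inl (@Ordinal 3 0 isT).
Let b : H := inl (@Ordinal 3 1 isT).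
Let c : H := inl (@Ordinal 3 2 isT).

Definition exceptional : {set {set H}} := [set [set a]; [set b]; [set c]; [set a; c]].

Lemma card_exceptional : #|exceptional| <= 4.
Proof.
do 2!rewrite (leq_trans (leq_card_setU _ _)) // cards1 addn1 ltnS.
by rewrite cards2; case: (_ != _).
Qed.

Lemma class_le_generic N : N \notin exceptional -> #|trace_class N| <= t.
Proof.
move=> Nexc.
case: (boolP [exists i, inr i \in N]) => [/existsP[i iN]|/existsPn noI].
  (* An isolated vertex as pivot partner leaves the path untouched. *)
  by apply: (@class_le N (inr i) a b c iN); rewrite /contracted /= ?andbF.
have NE (M : {set H}) : (forall i, inr i \notin M) ->
    a \in M = (a \in N) -> b \in M = (b \in N) -> c \in M = (c \in N) -> N = M.
  move=> noJ ea eb ec; apply/setP => -[k|i]; last by rewrite (negbTE (noI i)) (negbTE (noJ i)).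
  have [->|->|->] : [\/ inl k = a, inl k = b | inl k = c] by
    case: k => [[|[|[]]]] // lt; [apply: Or31|apply: Or32|apply: Or33];
    congr inl; apply: val_inj.
  - by rewrite ea.
  - by rewrite eb.
  - by rewrite ec.
(* The closed neighbourhood of [b] is the whole path, so contracting through [b] toggles exactly the
   path pairs with one end in [N]. *)
have P3 p q r : b \in N -> p != r -> contracted N b p q -> contracted N b q r ->
  ~~ contracted N b p r -> #|trace_class N| <= t by apply: class_le.
case: (boolP (a \in N)) => aN; case: (boolP (b \in N)) => bN;
  case: (boolP (c \in N)) => cN.
- by apply: (P3 a b c); rewrite // /contracted ?aN ?bN ?cN.
- by apply: (P3 b a c); rewrite // /contracted ?aN ?bN ?(negbTE cN).
- case/negP: Nexc; rewrite (NE [set a; c]) ?inE ?aN ?(negbTE bN) ?cN ?eqxx ?orbT //.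
  by move=> i; rewrite !inE.
- case/negP: Nexc; rewrite (NE [set a]) ?inE ?aN ?(negbTE bN) ?(negbTE cN) ?eqxx ?orbT //.
  by move=> i; rewrite !inE.
- by apply: (P3 b c a); rewrite // /contracted ?(negbTE aN) ?bN ?cN.
- case/negP: Nexc; rewrite (NE [set b]) ?inE ?bN ?(negbTE aN) ?(negbTE cN) ?eqxx ?orbT //.
  by move=> i; rewrite !inE.
- case/negP: Nexc; rewrite (NE [set c]) ?inE ?cN ?(negbTE aN) ?(negbTE bN) ?eqxx ?orbT //.
  by move=> i; rewrite !inE.
have -> : trace_class N = set0; last by rewrite cards0.
apply/setP => v; rewrite in_set0 inE; apply/negP => /andP[ov /eqP ev].
case/negP: (trace_neq0 ov); rewrite ev; apply/eqP/NE;
  by rewrite ?in_set0 ?(negbTE aN) ?(negbTE bN) ?(negbTE cN) // => i; rewrite in_set0.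
Qed.

Lemma card_minimal_graph : 0 < t -> #|G| <= (t + 3) + (t * 2 ^ (t + 3) + 4 * t).
Proof.
move=> t0; have [inj _] := copy_phi.
have cardH : #|{: H}| = t + 3 by rewrite card_sum !card_ord addnC.
have -> : #|G| = #|codom phi| + #|[set v | outside v]|.
  rewrite -(cardC (mem (codom phi))); congr addn.
  by apply: eq_card => v; rewrite !inE.
rewrite (card_codom inj) cardH leq_add2l.
rewrite -sum1_card (partition_big trace predT) //=.
have cardset : #|{set H}| = 2 ^ (t + 3).
  by rewrite -cardsT -powersetT card_powerset cardsT cardH.
apply: (@leq_trans (\sum_(N : {set H}) (t + (N \in exceptional) * t))).
  apply: leq_sum => N _.
  have -> : \sum_(v in [set v | outside v] | trace v == N) 1 = #|trace_class N|.
    by rewrite sum1dep_card; apply: eq_card => v; rewrite !inE.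
  case: (boolP (N \in exceptional)) => [_|/class_le_generic leZ].
    by rewrite mul1n; apply: class_le_double.
  by rewrite mul0n addn0.
rewrite big_split /= sum_nat_const cardset mulnC leq_add2l -big_distrl /=.
by rewrite leq_mul2r -big_mkcond sum1_card card_exceptional orbT.
Qed.

End MinimalGraph.

(* The subtraction is not truncated: t + 4 <= 2 ^ (t + 3) for every t. *)
Theorem theorem4p16 (t : nat) (G : sgraph) :
  0 < t ->
  minimal_with_pivot_minor (P3_plus_P1s t) G ->
  #|G| <= (t + 1) * (2 ^ (t + 3) - t - 4) + 2.
Proof.
move=> t0 minG; have [[K GK [f [f' fK f'K] fhom]] _] := minG.
have [X [B [symB irrB tX tX' [phi [inj hom]]]]] := pivot_minor_twist GK.
have copy_phi : copy B (phi \o f').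
  split=> [|x y] /=; first exact: inj_comp inj (can_inj f'K).
  by rewrite hom -fhom !f'K.
apply: leq_trans (card_minimal_graph minG symB irrB tX tX' copy_phi t0) _.
(* The difference of the two sides here is that of the claimed bound and the count. It is 0 at
   [t = 1], the base of the induction. *)
suff : t * t + 10 * t + 5 <= 2 ^ (t + 3) by nia.
case: t t0 {minG copy_phi f f' fK f'K fhom phi inj hom} => // t _.
elim: t => // t IHt; rewrite (addSn t.+1) expnS.
by apply: leq_trans (leq_mul (leqnn 2) IHt); nia.
Qed.
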